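(* Let $1<p<+\infty$. The sequence of operators $\{\mathcal{GK}_n:L^p[0,\pi]\to L^p[0,\pi]\}_{n\in\mathbb{N}}$ is uniformly bounded on $L^p[0,\pi]$; that is, there is a constant $C_p>0$ such that $\|\mathcal{GK}_n(f)\|_p\le C_p\|f\|_p$ for all $n\in\mathbb{N}$ and all $f\in L^p[0,\pi]$.
   Context: For $n\in\mathbb{N}$ and $k=1,\dots,n$ let $\theta_k^{(n)}=\frac{(2k-1)\pi}{2n}$ and, for real $\theta$, let $$P_k(\theta)=(-1)^{k+1}\frac{\cos(n\theta)\sin\theta_k^{(n)}}{n(\cos\theta-\cos\theta_k^{(n)})}$$ (the dependence on $n$ is suppressed; $P_k$ is extended by continuity at the removable singularities, so it is a polynomial in $\cos\theta$, namely the fundamental Lagrange polynomial at the Chebyshev nodes $\cos\theta_k^{(n)}$ evaluated at $\cos\theta$). The Grünwald–Kantorovich operators are defined for integrable $f$ on $[0,\pi]$ and $\theta\in[0,\pi]$ by $$\mathcal{GK}_n(f)(\theta)=\frac{n}{\pi}\sum_{k=1}^n\left(\int_{\theta_k^{(n)}}^{\theta_k^{(n)}+\frac{\pi}{2n}}f(t)\,dt\right)\left\{P_k\left(\theta+\frac{\pi}{2n}\right)+P_k\left(\theta-\frac{\pi}{2n}\right)\right\}.$$ *)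

(* Defs.v *)
From mathcomp Require Import all_boot all_order all_algebra.
From mathcomp Require Import all_classical all_reals all_analysis.
From mathcomp Require Import ring lra.
Import Order.TTheory GRing.Theory Num.Theory.
Import numFieldNormedType.Exports.

Set Implicit Arguments.
Unset Strict Implicit.
Unset Printing Implicit Defensive.

Local Open Scope classical_set_scope.
Local Open Scope ring_scope.

Definition cheb_angle {R : realType} (n k : nat) : R :=
  ((2 * k)%:R - 1) * pi / (2 * n)%:R.

(* At a removable singularity (cos t = cos theta_k) the value is the limit 1,
   as for a fundamental Lagrange polynomial at its own node; see
   continuous_fund_lagrange below. *)
Definition fund_lagrange {R : realType} (n k : nat) (t : R) : R :=
  let tk := cheb_angle n k in
  if cos t == cos tk then 1
  else (-1) ^+ k.+1 * (cos (n%:R * t) * sin tk / (n%:R * (cos t - cos tk))).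

Section continuity.
Context {R : realType}.

Let cos_sin_nat n : exists T U : R -> R, forall x : R,
  cos (n%:R * x) = T (cos x) /\ sin (n%:R * x) = sin x * U (cos x).
Proof.
elim: n => [|n [T [U TU]]].
  by exists (cst 1), (cst 0) => x; rewrite mul0r cos0 sin0 mulr0.
exists (fun c => T c * c - (1 - c ^+ 2) * U c), (fun c => U c * c + T c) => x.
have [TE UE] := TU x.
rewrite -natr1 mulrDl mul1r cosD sinD TE UE -sin2cos2; split; ring.
Qed.

Let cos_cheb_angle n k : (0 < n)%N -> cos (n%:R * cheb_angle n k) = 0 :> R.
Proof.
move=> n0; have -> : n%:R * cheb_angle n k = k%:R * pi - pi / 2 :> R.
  rewrite /cheb_angle !natrM; field.
  by rewrite pnatr_eq0 -lt0n.
rewrite cosBpihalf; elim: k => [|k IH]; first by rewrite mul0r sin0.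
by rewrite -natr1 mulrDl mul1r sinDpi IH oppr0.
Qed.

Let sin_cheb_angle n k : (0 < n)%N ->
  sin (n%:R * cheb_angle n k) = (-1) ^+ k.+1 :> R.
Proof.
move=> n0; have -> : n%:R * cheb_angle n k = k%:R * pi - pi / 2 :> R.
  rewrite /cheb_angle !natrM; field.
  by rewrite pnatr_eq0 -lt0n.
rewrite sinBpihalf; elim: k => [|k IH]; first by rewrite mul0r cos0 expr1.
by rewrite -natr1 mulrDl mul1r cosDpi exprS -IH mulN1r.
Qed.

Let sin_cheb_angle_gt0 n k : (0 < k <= n)%N -> 0 < sin (cheb_angle n k) :> R.
Proof.
move=> /andP[k0 kn]; have n0 : (0 < n)%N by exact: leq_trans kn.
have n0' : (0 : R) < (2 * n)%:R by rewrite ltr0n muln_gt0.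
have pi0 := pi_gt0 R.
have k1 : (1 : R) <= k%:R by rewrite ler1n.
have kn' : (k%:R : R) <= n%:R by rewrite ler_nat.
apply: sin_gt0_pi; apply/andP; split.
  rewrite /cheb_angle divr_gt0// mulr_gt0// natrM; lra.
rewrite /cheb_angle ltr_pdivrMr// mulrC ltr_pM2l// !natrM; lra.
Qed.

Lemma continuous_fund_lagrange n k : (0 < k <= n)%N ->
  continuous (@fund_lagrange R n k).
Proof.
move=> kn t; have /andP[k0 kn0] := kn.
have n0 : (0 < n)%N by exact: leq_trans kn0.
have nR : n%:R != 0 :> R by rewrite pnatr_eq0 -lt0n.
pose tk : R := cheb_angle n k.
have dcn : is_derive t 1 (fun x : R => cos (n%:R * x)) (- sin (n%:R * t) * n%:R).
  apply: (@is_derive1_comp R cos (fun x => n%:R * x) t (- sin (n%:R * t)) n%:R).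
  rewrite (_ : (fun x : R => n%:R * x) = n%:R \*: (@idfun R))//.
  by apply: is_derive_eq; rewrite [_ *: _]mulr1.
have ccos : {for t, continuous (@cos R)} by exact: continuous_cos.
have ccn : {for t, continuous (fun x : R => cos (n%:R * x))}.
  apply: differentiable_continuous; apply/derivable1_diffP.
  by case: dcn.
pose q x : R := (-1) ^+ k.+1 *
   (cos (n%:R * x) * sin tk / (n%:R * (cos x - cos tk))).
have [ctk|ctk] := eqVneq (cos t) (cos tk); last first.
  have cq : {for t, continuous q}.
    apply: cvgM; first exact: cvg_cst.
    apply: cvgM; first by apply: cvgM => //; exact: cvg_cst.
    apply: cvgV; first by rewrite mulf_neq0// subr_eq0.
    apply: cvgM; first exact: cvg_cst.
    by apply: cvgB => //; exact: cvg_cst.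
  have Pq : \forall x \near t, q x = fund_lagrange n k x.
    have : \forall x \near t, cos x - cos tk != 0.
      have cB : cos x - cos tk @[x --> t] --> cos t - cos tk.
        by apply: cvgB => //; exact: cvg_cst.
      have := @cvgr_neq0 R R^o R (nbhs t) _ (fun x => cos x - cos tk) _ cB.
      by apply; rewrite subr_eq0.
    apply: filterS => x; rewrite subr_eq0 => xk.
    by rewrite /fund_lagrange /= (negbTE xk).
  rewrite /continuous_at {2}/fund_lagrange (negbTE ctk).
  exact: (cvg_trans (near_eq_cvg Pq) cq).
apply/continuous_withinNshiftx.
have [T [U TU]] := cos_sin_nat n.
have stk0 := sin_cheb_angle_gt0 kn.
have cnt0 : cos (n%:R * t) = 0.
  by rewrite (TU t).1 ctk -(TU tk).1 cos_cheb_angle.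
have st0 : sin t != 0.
  rewrite -sqrf_eq0 sin2cos2 ctk -sin2cos2 sqrf_eq0; exact: lt0r_neq0.
have sE : sin (n%:R * t) = sin t * ((-1) ^+ k.+1 / sin tk).
  rewrite (TU t).2 ctk; congr (_ * _).
  by rewrite -(sin_cheb_angle k n0) (TU tk).2 mulrAC mulfV ?mul1r// lt0r_neq0.
have dc := is_derive_cos t.
have quo f df : is_derive t 1 f df ->
    h^-1 * (f (h + t) - f t) @[h --> (0 : R)^'] --> df.
  move=> [fd <-].
  suff -> : (fun h : R => h^-1 * (f (h + t) - f t)) =
    (fun h : R => h^-1 *: ((f \o shift t) (h *: (1 : R)) - f t)) by exact: fd.
  by apply/boolp.funext => h /=; rewrite [h *: _]mulr1.
have qc := quo _ _ dc.
have qn := quo _ _ dcn.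
have nz : \forall h \near (0 : R)^', h^-1 * (cos (h + t) - cos t) != 0.
  have := @cvgr_neq0 R R^o R ((0 : R)^') _ _ _ qc.
  by apply; rewrite oppr_eq0.
pose r h : R := (-1) ^+ k.+1 * (h^-1 * (cos (n%:R * (h + t)) - cos (n%:R * t))
   * sin tk / (n%:R * (h^-1 * (cos (h + t) - cos t)))).
have Pr : \forall h \near (0 : R)^', r h = (fund_lagrange n k \o shift t) h.
  apply: filterS nz => h hnz.
  have [h0 hc] : h^-1 != 0 /\ cos (h + t) - cos t != 0.
    by move: hnz; rewrite mulf_eq0 negb_or => /andP.
  rewrite /= /fund_lagrange -/tk -ctk -subr_eq0 (negbTE hc) /r cnt0 subr0.
  by field; rewrite hc nR -invr_eq0 h0.
rewrite {2}/fund_lagrange ctk eqxx.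
apply: (cvg_trans (near_eq_cvg Pr)).
have -> : 1 = (-1) ^+ k.+1 * ((- sin (n%:R * t) * n%:R) * sin tk /
   (n%:R * (- sin t))) :> R.
  rewrite sE; transitivity (((-1) ^+ k.+1 : R) ^+ 2).
    by rewrite -exprM mulnC exprM sqrrN expr1n expr1n.
  by field; rewrite nR st0 lt0r_neq0.
apply: cvgM; first exact: cvg_cst.
apply: cvgM; first by apply: cvgM => //; exact: cvg_cst.
apply: cvgV; first by rewrite mulf_neq0// oppr_eq0.
by apply: cvgM => //; exact: cvg_cst.
Qed.

End continuity.

Definition grunwald_kantorovich {R : realType} (n : nat) (f : R -> R) (t : R)
    : R :=
  let h : R := pi / (2 * n)%:R in
  n%:R / pi * \sum_(1 <= k < n.+1)
    (\int[lebesgue_measure]_(x in `[cheb_angle n k, (cheb_angle n k + h)]) f x)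
      * (fund_lagrange n k (t + h) + fund_lagrange n k (t - h)).

(* A function on [0, pi] is represented by a function on R whose values outside
   [0, pi] are irrelevant: f \_ `[0, pi] replaces them by 0. *)
Definition in_Lp_0pi {R : realType} (p : R) (f : R -> R) : Prop :=
  f \_ `[0, pi] \in Lfun lebesgue_measure p%:E.

Definition norm_Lp_0pi {R : realType} (p : R) (f : R -> R) : \bar R :=
  'N[lebesgue_measure]_p%:E[EFin \o (f \_ `[0, pi])].

(* Main.v *)
(* With h = pi / (2n), the k-th kernel P_k(t + h) + P_k(t - h) is bounded by 4
   everywhere and by 16 (h / (t - theta_k))^2 once |t - theta_k| >= 2h: shifting
   by +h and -h turns cos(n t) into opposite multiples of sin(n t), so the
   1/(t - theta_k) tails of the two Lagrange polynomials cancel.  Cutting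
   [0, pi] into n cells of length 2h centred at the nodes, the operator is
   therefore dominated by a discrete convolution with the summable sequence
   1/(1 + |i - j|)^2 acting on the averages of |f| over the node intervals;
   the Schur test and Jensen's inequality give the L^p bound. *)

Require Import Defs.
From mathcomp Require Import all_boot all_order all_algebra.
From mathcomp Require Import all_classical all_reals all_analysis.
From mathcomp Require Import measurable_realfun ring lra zify.
Import Order.TTheory GRing.Theory Num.Theory.
Import numFieldNormedType.Exports.

Set Implicit Arguments.
Unset Strict Implicit.

Local Open Scope classical_set_scope.
Local Open Scope ring_scope.

(** * Elementary bounds for sine and cosine *)

Section sine.
Context {R : realType}.
Implicit Types (x y : R) (n k : nat).

Lemma norm_sin_natmul_le n x : `|sin (n%:R * x)| <= n%:R * `|sin x|.
Proof.
elim: n => [|n IH]; first by rewrite !mul0r sin0 normr0.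
rewrite -natr1 2!mulrDl !mul1r sinD (le_trans (ler_normD _ _))// lerD//.
  by rewrite normrM (le_trans _ IH)// ler_piMr// cos_max.
by rewrite normrM ler_piMl// cos_max.
Qed.

Lemma sin_mean_value x : 0 < x -> exists2 c, 0 < c < x & sin x = x * cos c.
Proof.
move=> x0; have [|c] := @MVT R sin cos 0 x x0 (fun y _ => is_derive_sin y).
  exact/continuous_subspaceT/continuous_sin.
by rewrite in_itv/= sin0 !subr0 mulrC => cx ->; exists c.
Qed.

Lemma sin_le_id x : 0 <= x -> sin x <= x.
Proof.
rewrite le_eqVlt => /predU1P[<-|x0]; first by rewrite sin0.
by have [c _ ->] := sin_mean_value x0; rewrite ler_piMr ?cos_le1// ltW.
Qed.

Lemma cos_antitone x y : 0 <= x -> x <= y -> y <= pi -> cos y <= cos x.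
Proof.
move=> x0 xy ypi; rewrite le_eqVlt; have [->|/eqP nxy] := eqVneq x y.
  by rewrite eqxx.
apply/orP; right; rewrite ltr_cos ?in_itv/=.
- by rewrite lt_neqAle xy andbT; apply/eqP.
- by rewrite x0 (le_trans xy).
- by rewrite (le_trans x0 xy).
Qed.

(** Cosine decreases on [0, pi] and x <= y / 2, so [cos x] may be replaced by [cos (y / 2)]; the
    quarter z = y / 4 then brings both cosines under the doubling formula. The bound keeps the
    kernel's denominators away from 0 far from a node. *)
Lemma cos_sub_cos_ge x y : 0 <= x -> x *+ 2 <= y -> y <= pi ->
  y ^+ 2 / 16 <= cos x - cos y.
Proof.
move=> x0 xy ypi; have y0 : 0 <= y by lra.
have c2 : cos (y / 2) <= cos x by apply: cos_antitone; lra.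
apply: le_trans (lerB c2 (lexx _)) => {c2}.
have [->|ny0] := eqVneq y 0; first by rewrite mul0r subrr expr0n/= mul0r.
pose z := y / 4; have z0 : 0 < z by rewrite /z; lra.
have [c /andP[c0 cz] sz] := sin_mean_value z0.
have cz2 : 0 <= cos (z *+ 2).
  by apply: cos_ge0_pihalf; apply/andP; rewrite /z; split; lra.
have cz0 : 0 <= cos z.
  by apply: cos_ge0_pihalf; apply/andP; rewrite /z; split; lra.
have cc : cos z <= cos c by apply: cos_antitone; rewrite /z in cz *; lra.
have -> : y / 2 = z *+ 2 by rewrite /z; field.
have -> : y = z *+ 2 *+ 2 by rewrite /z; field.
(* With C = cos (2z) >= 0, the difference is (1 - C)(1 + 2C) >= 1 - C = 2 sin^2 z. The mean value
   form gives sin^2 z >= z^2 cos^2 z, and C >= 0 means cos^2 z >= 1/2, so the difference is at least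
   z^2 = y^2 / 16. *)
rewrite !cos_mulr2n; rewrite cos_mulr2n in cz2.
have sc := sin2cos2 z.
have cc2 : cos z ^+ 2 <= cos c ^+ 2 by rewrite lerXn2r ?nnegrE// (le_trans cz0).
have s2 : sin z ^+ 2 = z ^+ 2 * cos c ^+ 2 by rewrite sz exprMn.
have z2 : 0 <= z ^+ 2 by exact: sqr_ge0.
nra.
Qed.

End sine.

(** * Pointwise bounds for the fundamental polynomials and their shifted pairs *)

Section fundamental_polynomials.
Context {R : realType}.
Implicit Types (t : R) (n k : nat).

Lemma natmul_cheb_angle n k : (0 < n)%N ->
  n%:R * cheb_angle n k = k%:R * pi - pi / 2 :> R.
Proof.
by move=> n0; rewrite /cheb_angle !natrM; field; rewrite pnatr_eq0 -lt0n.
Qed.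

Lemma cos_natmul_cheb_angle n k : (0 < n)%N ->
  cos (n%:R * cheb_angle n k) = 0 :> R.
Proof.
move=> n0; rewrite natmul_cheb_angle// cosBpihalf.
elim: k => [|k IH]; first by rewrite mul0r sin0.
by rewrite -natr1 mulrDl mul1r sinDpi IH oppr0.
Qed.

Lemma cheb_angleE n k : (0 < n)%N ->
  cheb_angle n k = (k%:R *+ 2 - 1) * (pi / (2 * n)%:R) :> R.
Proof. by move=> n0; rewrite /cheb_angle natrM; ring. Qed.

Lemma cheb_angle_itv n k : (0 < k <= n)%N -> 0 <= (cheb_angle n k : R) <= pi.
Proof.
move=> /andP[k0 kn]; have n0 : (0 < n)%N by exact: leq_trans kn.
have n0' : (0 : R) < (2 * n)%:R by rewrite ltr0n muln_gt0.
have pi0 := pi_gt0 R.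
have k1 : (1 : R) <= k%:R by rewrite ler1n.
have kn' : (k%:R : R) <= n%:R by rewrite ler_nat.
apply/andP; split.
  by rewrite /cheb_angle divr_ge0 ?(ltW n0')// mulr_ge0 ?(ltW pi0)// natrM; lra.
rewrite /cheb_angle ler_pdivrMr// mulrC ler_pM2l// !natrM; lra.
Qed.

(** Since cos (n tk) = 0, numerator and denominator are both differences of cosines; in terms of A =
    (t + tk) / 2 and B = (t - tk) / 2 the quotient is, up to sign, sin (nA) sin (nB) sin tk / (n sin
    A sin B). As tk = A - B, |sin tk| <= |sin A| + |sin B|: each summand cancels one sine of the
    denominator, and |sin (nx)| <= n |sin x| absorbs the other. *)
Lemma norm_fund_lagrange_le2 n k t : (0 < n)%N -> `|fund_lagrange n k t| <= 2.
Proof.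
move=> n0; rewrite /fund_lagrange /=; set tk := cheb_angle n k.
case: ifPn => [_|]; first by rewrite normr1; lra.
rewrite -subr_eq0 => ctk.
pose A := (t + tk) / 2; pose B := (t - tk) / 2.
have n0R : 0 < n%:R :> R by rewrite ltr0n.
have tE : t = A + B by rewrite /A /B; field.
have tkE : tk = A - B by rewrite /A /B; field.
have cE : cos t - cos tk = - (sin A * sin B) *+ 2.
  by rewrite tE tkE cosD cosB; ring.
have cnE : cos (n%:R * t) = - (sin (n%:R * A) * sin (n%:R * B)) *+ 2.
  rewrite -[LHS]subr0 -(cos_natmul_cheb_angle k n0) -/tk tE tkE.
  by rewrite mulrDr mulrBr cosD cosB; ring.
have [a0 b0] : sin A != 0 /\ sin B != 0.
  move: ctk; rewrite cE mulrn_eq0/= oppr_eq0 mulf_eq0 negb_or.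
  by move=> /andP.
have sE : `|sin tk| <= `|sin A| + `|sin B|.
  rewrite tkE sinB (le_trans (ler_normB _ _))// !normrM lerD//.
    by rewrite ler_piMr// cos_max.
  by rewrite ler_piMl// cos_max.
rewrite normrM normrX normrN1 expr1n mul1r cnE cE.
have -> : - (sin (n%:R * A) * sin (n%:R * B)) *+ 2 * sin tk /
    (n%:R * (- (sin A * sin B) *+ 2)) =
  sin (n%:R * A) * sin (n%:R * B) * sin tk / (n%:R * (sin A * sin B)).
  by field; rewrite a0 b0 pnatr_eq0 -lt0n.
rewrite normrM normfV !normrM (ger0_norm (ltW n0R)).
rewrite -normr_gt0 in a0; rewrite -normr_gt0 in b0.
rewrite ler_pdivrMr ?mulr_gt0//.
have sA1 := sin_max (n%:R * A); have sB1 := sin_max (n%:R * B).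
have sA2 := norm_sin_natmul_le n A; have sB2 := norm_sin_natmul_le n B.
rewrite (le_trans (ler_wpM2l _ sE))// ?mulr_ge0// mulrDr.
have -> : 2 * (n%:R * (`|sin A| * `|sin B|)) =
  1 * (n%:R * `|sin B|) * `|sin A| + n%:R * `|sin A| * 1 * `|sin B|  by ring.
by rewrite lerD// ler_wpM2r// ler_pM.
Qed.

Lemma norm_fund_lagrange_pair_le4 n k t h : (0 < n)%N ->
  `|fund_lagrange n k (t + h) + fund_lagrange n k (t - h)| <= 4.
Proof.
move=> n0; rewrite (le_trans (ler_normD _ _))//.
have -> : 4 = 2 + 2 :> R by ring.
by rewrite lerD// norm_fund_lagrange_le2.
Qed.

(* With [d] and [s] the difference and sum of [t] and the node [tk], the two
   denominators have product (cos h - cos d)(cos h - cos s) and difference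
   - 2 sin t sin h, so that
   [2 sin t sin tk = (cos h - cos s) - (cos h - cos d)] cancels one factor. *)
Lemma norm_fund_lagrange_pair_far n k t (h := pi / (2 * n)%:R) :
  (0 < k <= n)%N -> 0 <= t <= pi -> h *+ 2 <= `|t - cheb_angle n k| ->
  `|fund_lagrange n k (t + h) + fund_lagrange n k (t - h)| <=
    16 / ((t - cheb_angle n k) / h) ^+ 2.
Proof.
move=> kn /[dup] t0pi /andP[t0 tpi].
have /andP[tk0 tkpi] := cheb_angle_itv kn.
have n0 : (0 < n)%N by case/andP: kn => ?; exact: leq_trans.
have n0R : 0 < n%:R :> R by rewrite ltr0n.
have pi0 := pi_gt0 R; have pi2 := pi_ge2 R.
have h0 : 0 < h by rewrite divr_gt0// ltr0n muln_gt0.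
set tk : R := cheb_angle n k in tk0 tkpi * => hd.
pose d := t - tk; pose s := t + tk.
have dpi : `|d| <= pi by rewrite ler_norml /d; apply/andP; split; lra.
(* The separation |d| >= 2h enters here: it makes cos h - cos d at least d^2 / 16. *)
have := cos_sub_cos_ge (ltW h0) hd dpi.
rewrite cos_norm -/d -[`|d| ^+ 2]normrX (ger0_norm (sqr_ge0 _)) => Xge.
have d20 : 0 < d ^+ 2.
  by rewrite exprn_even_gt0//= -normr_gt0; apply: lt_le_trans hd; lra.
have st0 : 0 <= sin t by exact: sin_ge0_pi.
have stk0 : 0 <= sin tk by apply: sin_ge0_pi; rewrite tk0.
have YX : (cos h - cos s) - (cos h - cos d) = sin t * sin tk *+ 2.
  by rewrite /d /s cosB cosD; ring.
set X := cos h - cos d in Xge YX *; set Y := cos h - cos s in YX *.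
have X0 : 0 < X by apply: lt_le_trans Xge; rewrite divr_gt0.
have Y0 : 0 < Y by have := mulr_ge0 st0 stk0; lra.
pose c1 := cos (t + h) - cos tk; pose c2 := cos (t - h) - cos tk.
have c12 : c1 * c2 = X * Y.
  rewrite /c1 /c2 /X /Y /d /s cosD cosB cosB cosD.
  have := sin2cos2 t; have := sin2cos2 tk; have := sin2cos2 h.
  set a := cos h; set b := cos t; set c := cos tk => h1 h2 h3.
  transitivity ((b * a - c) ^+ 2 - sin t ^+ 2 * sin h ^+ 2); first by ring.
  transitivity ((a - b * c) ^+ 2 - sin t ^+ 2 * sin tk ^+ 2); last by ring.
  by rewrite h1 h2 h3; ring.
have /andP[c10 c20] : (c1 != 0) && (c2 != 0).
  by rewrite -negb_or -mulf_eq0 c12 mulf_neq0// gt_eqF.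
have nh : n%:R * h = pi / 2 by rewrite /h natrM; field; rewrite pnatr_eq0 -lt0n.
have cn1 : cos (n%:R * (t + h)) = - sin (n%:R * t).
  by rewrite mulrDr nh cosDpihalf.
have cn2 : cos (n%:R * (t - h)) = sin (n%:R * t).
  by rewrite mulrBr nh cosBpihalf.
rewrite /fund_lagrange /= -/tk -[cos (t + h) == _]subr_eq0 -/c1 (negbTE c10).
rewrite -[cos (t - h) == _]subr_eq0 -/c2 (negbTE c20) -mulrDr cn1 cn2.
rewrite normrM normrX normrN1 expr1n mul1r.
have -> : - sin (n%:R * t) * sin tk / (n%:R * c1) + sin (n%:R * t) * sin tk /
    (n%:R * c2) = - sin (n%:R * t) * (sin h * ((Y - X) / (n%:R * (X * Y)))).
  rewrite -c12 YX.
  have -> : sin t * sin tk *+ 2 = sin tk * (sin t *+ 2) by ring.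
  have E : c1 - c2 = - (sin t * sin h) *+ 2 by rewrite /c1 /c2 cosD cosB; ring.
  transitivity (sin (n%:R * t) * sin tk * (c1 - c2) / (n%:R * (c1 * c2))).
    by field; rewrite c10 c20 pnatr_eq0 -lt0n.
  by rewrite E; field; rewrite c10 c20 pnatr_eq0 -lt0n.
rewrite normrM normrN (le_trans (ler_piMl _ (sin_max _)))//.
have hpi : h <= pi.
  rewrite /h ler_pdivrMr ?ltr0n ?muln_gt0// ler_peMr ?(ltW pi0)//.
  by rewrite ler1n muln_gt0.
have sh0 : 0 <= sin h by apply: sin_ge0_pi; rewrite (ltW h0).
have YX0 : 0 <= Y - X by rewrite YX mulrn_wge0// mulr_ge0.
rewrite ger0_norm; last by rewrite mulr_ge0// divr_ge0// ?mulr_ge0// ltW.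
(* Here sin h <= h, and Y - X <= Y <= n h Y because n h = pi / 2 >= 1. *)
apply: (@le_trans _ _ (h * (h / X))).
  apply: ler_pM => //; first by rewrite divr_ge0// ?mulr_ge0// ltW.
    by apply: sin_le_id; exact: ltW.
  rewrite ler_pdivrMr ?mulr_gt0//.
  have -> : h / X * (n%:R * (X * Y)) = n%:R * h * Y.
    by field; rewrite gt_eqF.
  rewrite nh; nra.
rewrite expr_div_n invf_div mulrA -expr2 [leRHS]mulrCA ler_wpM2l ?sqr_ge0//.
by rewrite -invf_div lef_pV2 ?posrE ?divr_gt0.
Qed.

End fundamental_polynomials.

(** * Summable decay, Jensen's inequality for sums and the Schur test *)

Section discrete.
Context {R : realType}.

(* The truncated subtractions add up to |i - j|. *)
Definition quadratic_decay (i j : nat) : R :=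
  8 / ((i - j + (j - i)).+1%:R ^+ 2).

Lemma quadratic_decay_ge0 i j : 0 <= quadratic_decay i j.
Proof. by rewrite divr_ge0// sqr_ge0. Qed.

Lemma quadratic_decayC i j : quadratic_decay i j = quadratic_decay j i.
Proof. by rewrite /quadratic_decay addnC. Qed.

Lemma inv_sqr_le_telescope m :
  (m.+2%:R ^+ 2)^-1 <= m.+1%:R^-1 - m.+2%:R^-1 :> R.
Proof.
have m1 : 0 < m.+1%:R :> R by rewrite ltr0n.
have m2 : 0 < m.+2%:R :> R by rewrite ltr0n.
have -> : m.+1%:R^-1 - m.+2%:R^-1 = (m.+1%:R * m.+2%:R)^-1 :> R.
  rewrite -!natr1 in m1 m2 *; field; lra.
by rewrite lef_pV2 ?posrE ?exprn_gt0 ?mulr_gt0// expr2 ler_pM2r// ler_nat.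
Qed.

Lemma sum_quadratic_decay_le n j : \sum_(i < n) quadratic_decay i j <= 24.
Proof.
have -> : 24 = 8 * 3 :> R by ring.
under eq_bigr do rewrite /quadratic_decay.
rewrite -mulr_sumr ler_pM2l//.
(* Strengthened for induction: the telescoped tail bounds the partial sum up to n <= j; the diagonal
   term then adds 1, and the terms beyond j add less than 1 more. Hence the total 3. *)
suff : \sum_(i < n) ((i - j + (j - i)).+1%:R ^+ 2)^-1 <=
    if (n <= j)%N then (j - n).+1%:R^-1 else 3 - (n - j)%:R^-1 :> R.
  move=> /le_trans; apply; case: leqP => _.
    by rewrite (@le_trans _ _ 1)// ?ler1n// invf_le1// ?ltr0n// ler1n.
  by rewrite gerBl invr_ge0.
elim: n => [|n IH]; first by rewrite big_ord0 leq0n invr_ge0.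
rewrite big_ord_recr/=; apply: (le_trans (lerD IH (lexx _))).
have [nj|jn|<-] := ltngtP n j.
- have -> : (n - j + (j - n)).+1 = (j - n.+1).+2 by lia.
  have -> : (j - n).+1 = (j - n.+1).+2 by lia.
  by rewrite -lerBrDl; exact: inv_sqr_le_telescope.
- have -> : (n - j + (j - n)).+1 = (n - j.+1).+2 by lia.
  have -> : (n.+1 - j)%N = (n - j.+1).+2 by lia.
  have -> : (n - j)%N = (n - j.+1).+1 by lia.
  by rewrite -addrA lerD2l -lerBrDl opprK addrC; exact: inv_sqr_le_telescope.
- by rewrite !subnn subSnn expr1n invr1; lra.
Qed.

(** Young's inequality for a and s^(p-1) with exponents p and p / (p - 1), multiplied by p. It says
    that the graph of the p-th power lies above its tangent at s; both Jensen inequalities below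
    follow by summing or integrating it at a well-chosen s. *)
Lemma powR_tangent (p a s : R) : 1 < p -> 0 <= a -> 0 <= s ->
  p * s `^ (p - 1) * a <= a `^ p + (p - 1) * s `^ p.
Proof.
move=> p1 a0 s0; have p0 : 0 < p by lra.
have := @conjugate_powR R a (s `^ (p - 1)) p (p / (p - 1)) a0 (powR_ge0 _ _) p0.
rewrite -powRrM mulrCA divff ?mulr1; last by rewrite subr_eq0 gt_eqF.
have -> : p^-1 + (p / (p - 1))^-1 = 1 by rewrite invf_div; field; lra.
rewrite divr_gt0 ?subr_gt0// => /(_ isT erefl).
rewrite -(ler_pM2l p0) => h.
have -> : p * s `^ (p - 1) * a = p * (a * s `^ (p - 1)) by ring.
apply: (le_trans h); rewrite invf_div le_eqVlt; apply/orP; left; apply/eqP.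
by field; lra.
Qed.

Lemma jensen_sum (p W : R) n (w a : nat -> R) : 1 < p -> 0 < W ->
  (forall i, 0 <= w i) -> (forall i, 0 <= a i) -> \sum_(i < n) w i <= W ->
  (\sum_(i < n) w i * a i) `^ p <= W `^ (p - 1) * \sum_(i < n) w i * a i `^ p.
Proof.
move=> p1 W0 w0 a0 wW.
set S := \sum_(i < n) w i * a i.
have S0 : 0 <= S by apply: sumr_ge0 => i _; rewrite mulr_ge0.
(* The tangent point is S / W, with the bound W in place of the total weight. The tangent
   inequalities then sum to p s^p W <= sum w a^p + (p - 1) s^p W, which leaves s^p W on the left. *)
pose s := S / W; have s0 : 0 <= s by rewrite divr_ge0// ltW.
have sS : S = s * W by rewrite /s mulfVK// gt_eqF.
have ssp : s `^ (p - 1) * s = s `^ p by rewrite mulrC mulr_powRB1//; lra.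
have : p * s `^ (p - 1) * S <=
    \sum_(i < n) w i * a i `^ p + (p - 1) * s `^ p * \sum_(i < n) w i.
  rewrite /S !mulr_sumr -big_split/= ler_sum// => i _.
  have := ler_wpM2l (w0 i) (powR_tangent p1 (a0 i) s0).
  by move=> h; lra.
have c0 : 0 <= (p - 1) * s `^ p by rewrite mulr_ge0 ?powR_ge0//; lra.
move: (ler_wpM2l c0 wW) => h1 h2.
have {h1 h2} := le_trans h2 (lerD (lexx _) h1).
rewrite sS -[p * _ * _]mulrA [s `^ _ * (_ * _)]mulrA ssp => h.
have {}h : s `^ p * W <= \sum_(i < n) w i * a i `^ p by lra.
rewrite powRM ?(ltW W0)// -(mulr_powRB1 (ltW W0) (lt_trans _ p1))//.
have -> : s `^ p * (W * W `^ (p - 1)) = W `^ (p - 1) * (s `^ p * W) by ring.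
by rewrite ler_wpM2l// powR_ge0.
Qed.

(** Jensen's inequality for fixed j uses the bound on sums over i and costs W^(p-1); after
    exchanging the sums, the bound on sums over j supplies the last factor W. *)
Lemma schur_test (p W : R) n (v : nat -> nat -> R) (a : nat -> R) :
  1 < p -> 0 < W -> (forall i j, 0 <= v i j) -> (forall i, 0 <= a i) ->
  (forall j, \sum_(i < n) v i j <= W) -> (forall i, \sum_(j < n) v i j <= W) ->
  \sum_(j < n) (\sum_(i < n) v i j * a i) `^ p <=
    W `^ p * \sum_(i < n) a i `^ p.
Proof.
move=> p1 W0 v0 a0 vc vr.
apply: (@le_trans _ _ (\sum_(j < n) W `^ (p - 1) *
    \sum_(i < n) v i j * a i `^ p)).
  by apply: ler_sum => j _; apply: (@jensen_sum _ _ _ (v ^~ j)).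
rewrite -mulr_sumr exchange_big/= -(mulr_powRB1 (ltW W0) (lt_trans _ p1))//.
rewrite [W * _]mulrC -mulrA ler_wpM2l ?powR_ge0// mulr_sumr ler_sum// => i _.
by rewrite -mulr_suml ler_wpM2r// powR_ge0.
Qed.

End discrete.

(** * The kernel on cells of length 2h *)

Section cells.
Context {R : realType}.

(** The node of index i + 1 is (2i + 1)h, the centre of cell i. For |i - j| <= 1 the uniform bound 4
    = 16 / 2^2 suffices; otherwise the far estimate applies. *)
Lemma norm_fund_lagrange_pair_cell n i j (t : R) (h := pi / (2 * n)%:R) :
  (i < n)%N -> (j < n)%N -> j%:R * (h *+ 2) <= t <= j.+1%:R * (h *+ 2) ->
  `|fund_lagrange n i.+1 (t + h) + fund_lagrange n i.+1 (t - h)| <=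
    2 * quadratic_decay i j.
Proof.
move=> iltn jltn /andP[tj tj1]; have n0 : (0 < n)%N by exact: leq_trans iltn.
have h0 : 0 < h by rewrite divr_gt0 ?pi_gt0// ltr0n muln_gt0.
rewrite /quadratic_decay; set D := (i - j + (j - i))%N.
have -> : 2 * (8 / D.+1%:R ^+ 2) = 16 / D.+1%:R ^+ 2 :> R by ring.
have D1 : 0 < D.+1%:R :> R by rewrite ltr0n.
have [D2|D2] := leqP D 1.
  apply: le_trans (norm_fund_lagrange_pair_le4 _ _ _ n0) _.
  rewrite ler_pdivlMr ?exprn_gt0//.
  have : D.+1%:R ^+ 2 <= 2 ^+ 2 :> R by rewrite lerXn2r ?nnegrE// ler_nat.
  by lra.
have nh : n%:R * (h *+ 2) = pi.
  by rewrite /h natrM; field; rewrite pnatr_eq0 -lt0n.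
have tpi : 0 <= t <= pi.
  have h2 : 0 < h *+ 2 by rewrite mulrn_wgt0.
  apply/andP; split; first by apply: le_trans tj; rewrite mulr_ge0// ltW.
  by apply: (le_trans tj1); rewrite -nh ler_pM2r// ler_nat.
(* The distance from cell j to the centre of cell i is (2D - 1)h, at least (D + 1)h as D >= 2. *)
have dE : D.+1%:R * h <= `|t - cheb_angle n i.+1|.
  rewrite cheb_angleE// -/h -natr1.
  have [ij|ji] := leqP i j.
    have Dij : (D + i)%:R = j%:R :> R by congr (_%:R); rewrite /D; lia.
    have : 2%:R <= D%:R :> R by rewrite ler_nat.
    rewrite natrD in Dij; rewrite -(ler_pM2r h0) => D2h.
    have := ler_norm (t - (i.+1%:R *+ 2 - 1) * h).
    apply: le_trans; rewrite -natr1; rewrite -Dij in tj; nra.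
  have Dij : (D + j)%:R = i%:R :> R by congr (_%:R); rewrite /D; lia.
  have : 2%:R <= D%:R :> R by rewrite ler_nat.
  rewrite natrD in Dij; rewrite -(ler_pM2r h0) => D2h.
  have := ler_norm (- (t - (i.+1%:R *+ 2 - 1) * h)).
  rewrite normrN; apply: le_trans; rewrite -[i.+1%:R]natr1 -Dij.
  rewrite -natr1 in tj1; nra.
have i1n : (0 < i.+1 <= n)%N by [].
apply: le_trans (norm_fund_lagrange_pair_far i1n tpi _) _; rewrite -/h.
  apply: le_trans dE; rewrite -mulr_natl ler_pM2r// ler_nat; lia.
have qE : D.+1%:R <= `|(t - cheb_angle n i.+1) / h|.
  by rewrite normrM normfV (gtr0_norm h0) ler_pdivlMr.
rewrite -[X in _ / X](ger0_norm (sqr_ge0 _)) normrX.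
have q0 := lt_le_trans D1 qE.
by rewrite ler_pM2l// lef_pV2 ?posrE ?exprn_gt0// lerXn2r ?nnegrE// ltW.
Qed.

Lemma mem_cell n (d t : R) : 0 <= t -> t <= n.+1%:R * d ->
  exists2 j, (j < n.+1)%N & j%:R * d <= t <= j.+1%:R * d.
Proof.
move=> t0; elim: n => [|n IH] tn; first by exists 0%N; rewrite ?mul0r ?t0.
have [tn'|/ltW tn'] := leP t (n.+1%:R * d).
  by have [j jn jt] := IH tn'; exists j => //; exact: ltnW.
by exists n.+1; rewrite ?tn'.
Qed.

End cells.

(** * Integral estimates and the bound for the operator *)

Section integrals.
Context {R : realType}.
Notation mu := (@lebesgue_measure R).

Lemma jensen_Rintegral d (T : measurableType d) (nu : {measure set T -> \bar R})
    (A : set T) (p h : R) (f : T -> R) :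
  1 < p -> 0 < h -> measurable A -> nu A = h%:E -> measurable_fun A f ->
  (((`|\int[nu]_(x in A) f x| / h) `^ p * h)%:E <=
    \int[nu]_(x in A) (`|f x| `^ p)%:E)%E.
Proof.
move=> p1 h0 mA nuA mf; set r : R := `|_|; set s : R := r / h.
have s0 : 0 <= s by apply: divr_ge0; [exact: normr_ge0|exact: ltW].
have p0 : 0 < p by lra.
have mnf : measurable_fun A (fun x => `|f x|) by exact: measurableT_comp.
have mfp : measurable_fun A (fun x => `|f x| `^ p).
  exact: (measurableT_comp (measurable_powR p)).
have c0 : 0 <= p * s `^ (p - 1) by rewrite mulr_ge0 ?powR_ge0// ltW.
(* No integrability of f is assumed: if its integral is infinite, [Rintegral] takes the default
   value 0 and the inequality is trivial. *)
have rA : (r%:E <= \int[nu]_(x in A) `|f x|%:E)%E.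
  apply: (@le_trans _ _ `|\int[nu]_(x in A) (f x)%:E|%E).
    by rewrite /r /Rintegral; case: (integral _ _ _) => //=;
      rewrite normr0 leey.
  by apply: le_abse_integral => //; exact/measurable_EFinP.
have : (\int[nu]_(x in A) (p * s `^ (p - 1) * `|f x|)%:E <=
    \int[nu]_(x in A) (`|f x| `^ p + (p - 1) * s `^ p)%:E)%E.
  apply: ge0_le_integral => //.
  - by move=> x _; rewrite lee_fin mulr_ge0.
  - by apply/measurable_EFinP; exact: measurable_funM.
  - by apply/measurable_EFinP; exact: measurable_funD.
  - by move=> x _; rewrite lee_fin powR_tangent.
have c1 : 0 <= (p - 1) * s `^ p by rewrite mulr_ge0 ?powR_ge0//; lra.
under eq_integral do rewrite EFinM.
rewrite ge0_integralZl_EFin//; last exact/measurable_EFinP.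
under [X in (_ <= X)%E]eq_integral do rewrite EFinD.
rewrite ge0_integralD//; last exact/measurable_EFinP.
rewrite integral_cst// nuA -EFinM.
have lB : (((p * s `^ (p - 1)) * r)%:E <=
  (p * s `^ (p - 1))%:E * \int[nu]_(x in A) `|f x|%:E)%E.
  by rewrite EFinM lee_wpmul2l// lee_fin.
move=> /(le_trans lB); have -> : r = s * h by rewrite /s mulfVK// gt_eqF.
have -> : p * s `^ (p - 1) * (s * h) = p * (s * s `^ (p - 1)) * h by ring.
rewrite mulr_powRB1// -leeBlDr// -EFinB => /(le_trans _); apply.
by rewrite lee_fin; lra.
Qed.

Lemma norm_Lp_0piE (p : R) (g : R -> R) : 0 < p ->
  norm_Lp_0pi p g =
    ((\int[mu]_(x in `[0%R, pi]) (`|g x| `^ p)%:E) `^ p^-1)%E.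
Proof.
move=> p0; rewrite /norm_Lp_0pi unlock; congr (_ `^ _)%E.
rewrite [RHS]integral_mkcond; apply: eq_integral => x _ /=.
rewrite /patch; case: ifPn => // _.
by rewrite normr0 powR0// gt_eqF.
Qed.

Lemma in_Lp_0piP (p : R) (g : R -> R) : in_Lp_0pi p g <->
  measurable_fun `[0, pi]%classic g /\ (norm_Lp_0pi p g < +oo)%E.
Proof.
rewrite /in_Lp_0pi; split.
  move=> gL; split.
    apply/(measurable_restrictT _ _).2 => //.
    by have := sub_Lfun_mfun gL; rewrite inE.
  by have := sub_Lfun_finLfun gL; rewrite inE.
move=> [mg gfin]; rewrite inE; apply/andP; split; rewrite inE//=.
exact/(measurable_restrictT _ _).1.
Qed.

Lemma continuous_grunwald_kantorovich n (f : R -> R) :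
  continuous (grunwald_kantorovich n f).
Proof.
move=> t; rewrite /grunwald_kantorovich; apply: cvgM; first exact: cvg_cst.
(* This records 1 <= k <= n inside the sum, the range in which [fund_lagrange n k] is known to be
   continuous. *)
rewrite big_seq; under eq_fun do rewrite big_seq.
apply: cvg_big => [|k]; first exact: add_continuous.
rewrite mem_index_iota => kn.
apply: cvgM; first exact: cvg_cst.
have cP := continuous_fund_lagrange kn.
apply: cvgD.
  apply: (@continuous_comp _ _ _ (fun x => x + _) (fund_lagrange n k));
    last exact: cP.
  by apply: cvgD => //; exact: cvg_cst.
apply: (@continuous_comp _ _ _ (fun x => x - _) (fund_lagrange n k));
    last exact: cP.
by apply: cvgB => //; exact: cvg_cst.
Qed.

Lemma node_cell_sub n i : (i < n)%N ->
  `[cheb_angle n i.+1, (cheb_angle n i.+1 + pi / (2 * n)%:R)] `<=` `[0, pi : R].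
Proof.
move=> iltn x /=; rewrite !in_itv/=.
have n0 : (0 < n)%N by exact: leq_trans iltn.
set h : R := pi / _.
have h0 : 0 < h by rewrite divr_gt0 ?pi_gt0// ltr0n muln_gt0.
have nh : n%:R *+ 2 * h = pi.
  by rewrite /h natrM; field; rewrite pnatr_eq0 -lt0n.
rewrite cheb_angleE// -/h -nh -natr1 => /andP[ix xi].
have in1 : i%:R + 1 <= n%:R :> R by rewrite natr1 ler_nat.
have i0 : 0 <= i%:R :> R by [].
apply/andP; split; first by apply: le_trans ix; nra.
by apply: (le_trans xi); nra.
Qed.

(** The intervals [(2i + 1)h, (2i + 2)h] are the right halves of the cells; gaps of length h make
    them disjoint although closed. *)
Lemma sum_integral_node_cells n (g : R -> \bar R) (h := pi / (2 * n)%:R) :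
  (0 < n)%N -> measurable_fun `[0, pi]%classic g -> (forall x, 0 <= g x)%E ->
  (\sum_(i < n)
      \int[mu]_(x in `[cheb_angle n i.+1, (cheb_angle n i.+1 + h)%R]) g x <=
    \int[mu]_(x in `[0%R, pi]) g x)%E.
Proof.
move=> n0 mg g0.
have h0 : 0 < h by rewrite divr_gt0 ?pi_gt0// ltr0n muln_gt0.
pose I i := `[cheb_angle n i.+1, (cheb_angle n i.+1 + h)]%classic.
have ID : \big[setU/set0]_(i <- index_iota 0 n) I i `<=` `[0, pi].
  by rewrite big_mkord -bigcup_mkord => x [i /= iltn]; exact: node_cell_sub.
have -> : (\sum_(i < n) \int[mu]_(x in I i) g x =
    \int[mu]_(x in \big[setU/set0]_(i <- index_iota 0 n) I i) g x)%E.
  rewrite ge0_integral_bigsetU ?big_mkord//.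
  - by move=> i; exact: measurable_itv.
  - exact: iota_uniq.
  - apply: (@sub_trivIset _ _ _ setT) => //; apply: ltn_trivIset => j i ij.
    apply/seteqP; split => // x []; rewrite /I/= !in_itv/= !cheb_angleE// -/h.
    move=> /andP[_ xi] /andP[jx _]; have := le_trans jx xi.
    have : i.+1%:R <= j%:R :> R by rewrite ler_nat.
    rewrite -!natr1; nra.
  - apply: measurable_funS mg => //.
    by move: ID; rewrite big_mkord.
apply: ge0_subset_integral => //.
by apply: bigsetU_measurable => i _; exact: measurable_itv.
Qed.

Lemma norm_grunwald_kantorovich_cell n (f : R -> R) j t (h := pi / (2 * n)%:R) :
  (j < n)%N -> j%:R * (h *+ 2) <= t <= j.+1%:R * (h *+ 2) ->
  `|grunwald_kantorovich n f t| <= \sum_(i < n) quadratic_decay i j *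
    (`|\int[mu]_(x in `[cheb_angle n i.+1, (cheb_angle n i.+1 + h)]) f x| / h).
Proof.
move=> jn tj; have n0 : (0 < n)%N by exact: leq_trans jn.
have h0 : 0 < h by rewrite divr_gt0 ?pi_gt0// ltr0n muln_gt0.
(* The prefactor 1 / (2h) turns the factor 2 of the kernel bound into a mean over an interval of
   length h. *)
have nh : n%:R / pi = (h *+ 2)^-1.
  have pi0 : pi != 0 :> R by rewrite gt_eqF// pi_gt0.
  rewrite /h natrM; move: (pi : R) pi0 => q q0.
  by field; rewrite q0 pnatr_eq0 -lt0n n0.
rewrite /grunwald_kantorovich -/h nh big_add1 big_mkord mulr_sumr.
rewrite (le_trans (ler_norm_sum _ _ _))// ler_sum// => i _.
rewrite 2!normrM normfV (gtr0_norm (_ : 0 < h *+ 2)) ?mulrn_wgt0//.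
have := norm_fund_lagrange_pair_cell (ltn_ord i) jn tj.
set F := `|_ + _|; set A := `|Rintegral _ _ _| => FE.
have -> : quadratic_decay i j * (A / h) =
    (h *+ 2)^-1 * (A * (2 * quadratic_decay i j)).
  by field; rewrite gt_eqF.
apply: ler_wpM2l; first by rewrite invr_ge0 mulrn_wge0// ltW.
by rewrite ler_wpM2l// /A normr_ge0.
Qed.

Lemma integral_grunwald_kantorovich_le (p : R) n (f : R -> R) :
  1 < p -> (0 < n)%N -> measurable_fun `[0, pi]%classic f ->
  (\int[mu]_(x in `[0%R, pi]) (`|grunwald_kantorovich n f x| `^ p)%:E <=
   (48 `^ p)%:E * \int[mu]_(x in `[0%R, pi]) (`|f x| `^ p)%:E)%E.
Proof.
move=> p1 n0 mf; have p0 : 0 < p by lra.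
pose h : R := pi / (2 * n)%:R.
have h0 : 0 < h by rewrite divr_gt0 ?pi_gt0// ltr0n muln_gt0.
have nh : n%:R * (h *+ 2) = pi.
  by rewrite /h natrM; field; rewrite pnatr_eq0 -lt0n.
pose I i := `[cheb_angle n i.+1, (cheb_angle n i.+1 + h)]%classic : set R.
pose J j := `[j%:R * (h *+ 2), (j.+1%:R * (h *+ 2))]%classic : set R.
pose a i := `|\int[mu]_(x in I i) f x| / h.
have a0 i : 0 <= a i by rewrite divr_ge0// ltW.
pose b j := \sum_(i < n) quadratic_decay i j * a i.
have b0 j : 0 <= b j.
  by apply: sumr_ge0 => i _; rewrite mulr_ge0// quadratic_decay_ge0.
have mfp : measurable_fun `[0, pi]%classic (fun x => (`|f x| `^ p)%:E).
  apply/measurable_EFinP; apply: (measurableT_comp (measurable_powR p)).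
  exact: measurableT_comp.
have IE (i : 'I_n) :
    ((a i `^ p * h)%:E <= \int[mu]_(x in I i) (`|f x| `^ p)%:E)%E.
  apply: jensen_Rintegral => //.
  - by rewrite /I /=; exact: measurable_itv.
  - rewrite /= /I lebesgue_measure_itv/= lte_fin ltrDl h0 -EFinB.
    by rewrite addrAC subrr add0r.
  - by apply: measurable_funS mf => //; exact: node_cell_sub.
have sumb : \sum_(j < n) b j `^ p <= 24 `^ p * \sum_(i < n) a i `^ p.
  apply: schur_test => //.
  - exact: quadratic_decay_ge0.
  - by move=> j; exact: sum_quadratic_decay_le.
  - move=> i; under eq_bigr do rewrite quadratic_decayC.
    exact: sum_quadratic_decay_le.
have bJ0 j x : (0 <= (b j `^ p)%:E * (\1_(J j) x)%:E)%E.
  by rewrite mule_ge0// lee_fin ?powR_ge0.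
have mJ j : measurable (J j) by exact: measurable_itv.
have mbJ j : measurable_fun `[0, pi]%classic
    (fun x => (b j `^ p)%:E * (\1_(J j) x)%:E)%E.
  by apply: measurable_funeM; apply/measurable_EFinP; exact: measurable_indic.
(* The closed cells overlap at endpoints, so the step function may count two terms there; keeping
   the one term whose cell contains x gives the pointwise inequality. *)
apply: (@le_trans _ _ (\int[mu]_(x in `[0%R, pi])
    \sum_(j < n) ((b j `^ p)%:E * (\1_(J j) x)%:E))%E).
  apply: ge0_le_integral => //.
  - apply/measurable_EFinP; apply: (measurableT_comp (measurable_powR p)).
    apply: measurableT_comp => //; apply: measurable_funTS.
    apply: continuous_measurable_fun.
    exact: continuous_grunwald_kantorovich.
  - by apply: emeasurable_sum => j; exact: (mbJ j).
  - move=> x; rewrite /= in_itv/= -nh => /andP[x0 xn].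
    rewrite -(prednK n0) in xn.
    have [j jn xj] := mem_cell x0 xn; rewrite prednK// in jn.
    rewrite (bigD1 (Ordinal jn))//=.
    have -> : \1_(J j) x = 1 :> R by rewrite indicE mem_set.
    rewrite mule1 -[leLHS]adde0 leeD//; last by apply: sume_ge0 => k _.
    rewrite lee_fin ge0_ler_powR ?nnegrE ?(ltW p0)//.
    exact: norm_grunwald_kantorovich_cell.
rewrite ge0_integral_sum//; last by move=> j; exact: mbJ.
apply: (@le_trans _ _ (\sum_(j < n) (b j `^ p * (h *+ 2))%:E)%E).
  apply: lee_sum => j _.
  rewrite ge0_integralZl_EFin ?powR_ge0//; last first.
    apply/measurable_EFinP; apply: measurable_indic; exact: mJ.
  rewrite integral_indic//; last exact: mJ.
  rewrite EFinM lee_wpmul2l ?lee_fin ?powR_ge0//.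
  apply: (@le_trans _ _ (mu (J j))); first last.
    rewrite /J lebesgue_measure_itv/=; case: ifPn => _.
      by rewrite -EFinB lee_fin -natr1; lra.
    by rewrite lee_fin mulrn_wge0// ltW.
  apply: le_measure; rewrite ?inE; [|exact: mJ|exact: subIsetl].
  by apply: measurableI; [exact: mJ|].
rewrite sumEFin -mulr_suml.
apply: (@le_trans _ _ ((48 `^ p)%:E * \sum_(i < n) (a i `^ p * h)%:E)%E).
  rewrite sumEFin -EFinM lee_fin -mulr_suml.
  (* The factor 24^p is the Schur bound; passing from cells of length 2h to node intervals of length
     h costs 2 <= 2^p. *)
  have -> : 48 `^ p = 2 `^ p * 24 `^ p :> R.
    by rewrite -powRM//; congr (_ `^ _); ring.
  have p2 : 2 <= 2 `^ p :> R by apply: le1r_powR; lra.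
  set S := \sum_(i < n) a i `^ p in sumb *.
  have S0 : 0 <= S by apply: sumr_ge0 => i _; exact: powR_ge0.
  have T0 : 0 <= 24 `^ p * S by rewrite mulr_ge0 ?powR_ge0.
  apply: (@le_trans _ _ (24 `^ p * S * (h *+ 2))).
    by rewrite ler_wpM2r// mulrn_wge0// ltW.
  have -> : 24 `^ p * S * (h *+ 2) = 2 * (24 `^ p * S * h) by ring.
  have -> : 2 `^ p * 24 `^ p * (S * h) = 2 `^ p * (24 `^ p * S * h) by ring.
  by rewrite ler_wpM2r// mulr_ge0// ltW.
rewrite lee_wpmul2l ?lee_fin ?powR_ge0//.
apply: (le_trans (lee_sum _ (fun i _ => IE i))).
exact: sum_integral_node_cells.
Qed.

End integrals.

Theorem lemma3p4 (R : realType) (p : R) (p_gt1 : 1 < p) :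
  exists C : R, 0 < C /\
    forall (n : nat) (f : R -> R), (0 < n)%N -> in_Lp_0pi p f ->
      in_Lp_0pi p (grunwald_kantorovich n f) /\
      (norm_Lp_0pi p (grunwald_kantorovich n f) <= C%:E * norm_Lp_0pi p f)%E.
Proof.
have p0 : 0 < p by lra.
exists 48; split=> // n f n0 /in_Lp_0piP[mf ffin].
suff le48 :
    (norm_Lp_0pi p (grunwald_kantorovich n f) <= 48%:E * norm_Lp_0pi p f)%E.
  split=> //; apply/in_Lp_0piP; split.
    apply: measurable_funTS.
    apply: continuous_measurable_fun.
    exact: continuous_grunwald_kantorovich.
  by rewrite (le_lt_trans le48)// lte_mul_pinfty.
rewrite !norm_Lp_0piE//.
have I0 (g : R -> R) :
    (0 <= \int[lebesgue_measure]_(x in `[0%R, pi]) (`|g x| `^ p)%:E)%E.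
  by apply: integral_ge0 => x _; rewrite lee_fin powR_ge0.
(* Writing 48 as a p-th root reduces the claim to the integral inequality by monotonicity of the
   power 1/p. *)
have -> : (48%:E = (48 `^ p)%:E `^ p^-1 :> \bar R)%E.
  by rewrite poweR_EFin -powRrM mulfV ?gt_eqF// powRr1.
rewrite -poweRM ?lee_fin ?powR_ge0//.
apply: gt0_ler_poweR; rewrite ?in_itv/= ?invr_ge0 ?(ltW p0) ?leey ?andbT//.
  by rewrite mule_ge0// lee_fin powR_ge0.
exact: integral_grunwald_kantorovich_le.
Qed.
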